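(* Let $(A,\mathfrak m)$ be a nonzero commutative local ring and let $R=\mathcal T(A)$. The nilradical and Jacobson radical of $R$ are $$\mathrm{Nil}(R)=\{(a,0):a\in\mathrm{Nil}(A)\},\qquad \mathrm{Jac}(R)=\{(a,0):a\in\mathfrak m\}.$$ In particular, $R$ is reduced if and only if $A$ is reduced. Every idempotent of $R$ is either $e_F$ or $1-e_F$ for a finite subset $F\subseteq\mathbb N$.
   Context: All rings are commutative with identity. For a nonzero local ring $(A,\mathfrak m)$ (not necessarily Noetherian) with residue field $\kappa=A/\mathfrak m$ and residue map $a\mapsto\bar a$, define the ring, with coordinatewise operations, $$\mathcal T(A)=\{(a,(c_i)_{i\in\mathbb N})\in A\times\kappa^{\mathbb N}: c_i=\bar a\text{ for all but finitely many }i\},\quad \mathbb N=\{1,2,\ldots\}.$$ $(a,0)$ denotes the element with first coordinate $a$ and zero sequence. For $i\in\mathbb N$, $e_i\in\mathcal T(A)$ is the element with first coordinate $0$ and sequence equal to $1$ in position $i$ and $0$ elsewhere; for finite $F\subseteq\mathbb N$, $e_F=\sum_{i\in F}e_i$ (so $e_\emptyset=0$). *)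

(* Defs.v *)
From HB Require Import structures.
From mathcomp Require Import all_boot all_order all_algebra.
From mathcomp Require Import finmap.
From mathcomp Require Import boolp classical_sets functions cardinality.

Set Implicit Arguments.
Unset Strict Implicit.
Unset Printing Implicit Defensive.

Import GRing.Theory.
Local Open Scope classical_set_scope.
Local Open Scope ring_scope.
Local Open Scope quotient_scope.

(* [idealr_closed] is the library's predicate for proper ideals, so the
   comparison below is with the proper ideals containing M. *)
Definition maximal_ideal (A : comNzRingType) (M : {pred A}) : Prop :=
  idealr_closed M /\
  forall J : {pred A}, idealr_closed J -> {subset M <= J} -> J =i M.

Definition is_local (A : comNzRingType) (m : {pred A}) : Prop :=
  maximal_ideal m /\ forall M : {pred A}, maximal_ideal M -> M =i m.

Definition nilradical (A : comNzRingType) : set A :=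
  [set a | exists n : nat, a ^+ n = 0].

Definition jacobson_radical (A : comNzRingType) : set A :=
  [set a | forall M : {pred A}, maximal_ideal M -> a \in M].

Arguments nilradical A : clear implicits.
Arguments jacobson_radical A : clear implicits.

Definition reduced (A : comNzRingType) : Prop :=
  forall a : A, nilradical A a -> a = 0.

Section TailRing.
Variables (A : comNzRingType) (m : idealr A).

Definition residue_ring : comNzRingType := {ideal_quot m}.

Definition residue (a : A) : residue_ring := \pi_({ideal_quot m}) a.

Lemma residue_is_zmod_morphism : zmod_morphism residue.
Proof. exact: rmorphB. Qed.

Lemma residue_is_monoid_morphism : monoid_morphism residue.
Proof. by split; [exact: rmorph1 | exact: rmorphM]. Qed.

HB.instance Definition _ :=
  GRing.isZmodMorphism.Build A residue_ring residue residue_is_zmod_morphism.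
HB.instance Definition _ :=
  GRing.isMonoidMorphism.Build A residue_ring residue
    residue_is_monoid_morphism.

(* The paper's index set {1, 2, ...} is shifted to [nat] = {0, 1, ...}. *)
Definition tail_ambient : comNzRingType := (A * (nat -> residue_ring))%type.

Definition tail_pred : {pred tail_ambient} :=
  fun x => `[< finite_set [set i | x.2 i != residue x.1] >].

Lemma tail_subring_closed : subring_closed tail_pred.
Proof.
split=> [|x y /asboolP xP /asboolP yP|x y /asboolP xP /asboolP yP];
  apply/asboolP.
- apply: (sub_finite_set _ (finite_set0 nat)) => i /=.
  by rewrite rmorph1 eqxx.
- have : finite_set ([set i | x.2 i != residue x.1]
                     `|` [set i | y.2 i != residue y.1]) by rewrite finite_setU.
  apply: sub_finite_set => i /= h; apply/orP; move: h; apply: contraNT.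
  rewrite negb_or !negbK rmorphB /= => /andP[/eqP <- /eqP <-]; exact: eqxx.
- have : finite_set ([set i | x.2 i != residue x.1]
                     `|` [set i | y.2 i != residue y.1]) by rewrite finite_setU.
  apply: sub_finite_set => i /= h; apply/orP; move: h; apply: contraNT.
  rewrite negb_or !negbK rmorphM /= => /andP[/eqP <- /eqP <-]; exact: eqxx.
Qed.

HB.instance Definition _ :=
  GRing.isSubringClosed.Build tail_ambient tail_pred tail_subring_closed.

Record tail_ring := TailRing {
  tail_val : tail_ambient;
  tail_valP : tail_val \in tail_pred
}.

HB.instance Definition _ := [isSub for tail_val].
HB.instance Definition _ := [Choice of tail_ring by <:].
HB.instance Definition _ := [SubChoice_isSubComNzRing of tail_ring by <:].

Definition unit_seq (i : nat) : tail_ambient :=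
  (0, fun j => if j == i then 1 else 0).

Lemma unit_seq_tail i : unit_seq i \in tail_pred.
Proof.
apply/asboolP; apply: (sub_finite_set _ (finite_set1 i)) => j /=.
by case: (j =P i) => // _; rewrite (rmorph0 residue) eqxx.
Qed.

Definition tail_e (i : nat) : tail_ring := TailRing (unit_seq_tail i).

Definition tail_eF (F : {fset nat}) : tail_ring := \sum_(i <- F) tail_e i.

End TailRing.

(* Main.v *)
(* Every coordinate of the sequence, and the residue of the first coordinate, is
   a surjection of the tail ring onto the residue field, so its kernel is
   maximal; these kernels intersect in the elements (a, 0) with a in m.
   Conversely 1 - y (a, 0) is a unit whenever a is in m, because elements
   outside m are units (by Zorn's lemma, a nonunit lies in a maximal ideal). An
   idempotent has head 0 or 1 because A is local; after replacing x by 1 - x the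
   head is 0, and then x is the indicator of its finite support. *)
Require Import Defs.
From HB Require Import structures.
From mathcomp Require Import all_boot all_order all_algebra.
From mathcomp Require Import finmap.
From mathcomp Require Import boolp classical_sets functions cardinality.

Set Implicit Arguments.
Unset Strict Implicit.
Unset Printing Implicit Defensive.

Import GRing.Theory.
Local Open Scope classical_set_scope.
Local Open Scope ring_scope.

(** * Maximal ideals and units of local rings *)

Section Ideals.
Variable A : comNzRingType.
Implicit Types (M : {pred A}) (a : A).

Lemma idealr_closedD M : idealr_closed M -> {in M &, forall a b, a + b \in M}.
Proof. by case=> _ _ h a b aM bM; rewrite -[a]mul1r h. Qed.

Lemma idealr_closedMl M : idealr_closed M ->
  forall c, {in M, forall a, c * a \in M}.
Proof. by case=> M0 _ h c a aM; rewrite -[_ * _]addr0 h. Qed.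

(** Otherwise the ideal [M + A a] omits 1, and maximality forces [a] into [M]. *)
Lemma maximal_ideal_inv M a : maximal_ideal M -> a \notin M ->
  exists c, 1 - c * a \in M.
Proof.
move=> [Mid Mmax] aM; apply: contrapT => nc.
have [M0 M1 Mlin] := Mid.
(* [J] is [M + A a]; the negated goal [nc] says exactly that 1 is not in it. *)
pose J : {pred A} := fun x => `[< exists c, x - c * a \in M >].
have JM : J =i M.
  apply: Mmax.
    split.
    - by apply/asboolP; exists 0; rewrite mul0r subr0.
    - by apply/asboolP.
    - move=> b x y /asboolP[c xM] /asboolP[d yM]; apply/asboolP.
      by exists (b * c + d); rewrite mulrDl opprD addrACA -mulrA -mulrBr Mlin.
  by move=> x xM; apply/asboolP; exists 0; rewrite mul0r subr0.
by move: aM; rewrite -JM => /asboolP; apply; exists 1; rewrite mul1r subrr.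
Qed.

(** If [J] contains [M] and some [x] outside [M], then 1 is the sum of [1 - c * x] and [c * x], both
    in [J]. *)
Lemma maximal_idealP M : idealr_closed M ->
  (forall a, a \notin M -> exists c, 1 - c * a \in M) -> maximal_ideal M.
Proof.
move=> Mid Minv; split=> // J Jid MJ x; apply/idP/idP; last exact: MJ.
move=> xJ; apply: contrapT => /negP /Minv[c /MJ cJ].
case: (Jid) => _ /negP J1 _; apply: J1.
by rewrite -[1](subrK (c * x)) idealr_closedD// idealr_closedMl.
Qed.

Lemma nonunit_in_maximal_ideal a : (forall c, c * a <> 1) ->
  exists2 M : {pred A}, maximal_ideal M & a \in M.
Proof.
move=> na.
(* The empty set is allowed so that the empty chain has an upper bound. *)
pose P (X : set A) := [/\ ~ X 1, (forall c x y, X x -> X y -> X (c * x + y))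
  & X !=set0 -> X a].
have [|X [[X1 Xlin Xa] Xmax]] := @Zorn_bigcup A P.
  move=> F FP Ftot; split.
  - by move=> [X /FP[]].
  - move=> c x y [X FX Xx] [Y FY Yy].
    have [XY|YX] := Ftot _ _ FX FY.
    + by exists Y => //; have [_ h _] := FP _ FY; apply: h => //; exact: XY.
    + by exists X => //; have [_ h _] := FP _ FX; apply: h => //; exact: YX.
  - by move=> [x [X FX Xx]]; exists X => //; have [_ _] := FP _ FX; apply; exists x.
(* If [X] omitted [a] it would be empty, and the principal ideal of [a] would be a strictly larger
   set satisfying [P]. *)
have {}Xa : X a.
  apply: contrapT => nXa.
  apply: (Xmax [set c * a | c in setT]).
    split=> [x Xx|h]; first by case: nXa; apply: Xa; exists x.
    by apply: nXa; apply: h; exists 1 => //; rewrite mul1r.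
  split.
  - by move=> [c _ /na].
  - move=> c _ _ [x _ <-] [y _ <-]; exists (c * x + y) => //.
    by rewrite mulrDl mulrA.
  - by exists 1 => //; rewrite mul1r.
exists (fun x => `[< X x >]); last exact/asboolP.
split.
  split.
  (* [P] has no clause for 0, which is recovered as [(-1) * a + a]. *)
  - apply/asboolP; have := Xlin (-1) _ _ Xa Xa.
    by rewrite mulN1r addNr.
  - exact/asboolP.
  - by move=> c x y /asboolP Xx /asboolP Xy; apply/asboolP; exact: Xlin.
move=> J [J0 J1 Jlin] XJ x; apply/idP/idP; last exact: XJ.
move=> xJ; apply/asboolP; apply: contrapT => nXx.
apply: (Xmax [set y | y \in J]).
  by split=> [y Xy|h]; [exact/XJ/asboolP | exact: nXx (h _ xJ)].
split=> /=.
- exact/negP.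
- by move=> c y z yJ zJ; apply: Jlin.
- by move=> _; exact/XJ/asboolP.
Qed.

Lemma local_unit (m : {pred A}) a : is_local m -> a \notin m ->
  exists c, c * a = 1.
Proof.
move=> [_ muniq] am; apply: contrapT => na.
have [c ca|M Mmax aM] := @nonunit_in_maximal_ideal a; first by apply: na; exists c.
by move: am; rewrite -(muniq _ Mmax) aM.
Qed.

(** One of [a] and [1 - a] lies outside [m], hence is a unit, and their product is 0. *)
Lemma local_idempotent (m : {pred A}) a : is_local m -> a * a = a ->
  a = 0 \/ a = 1.
Proof.
move=> ml aa; have [am|am] := boolP (a \in m).
  have /(local_unit ml)[c c1] : 1 - a \notin m.
    have [[mid _] _] := ml; have [_ m1 _] := mid.
    by apply: contraNN m1 => h; rewrite -(subrK a 1) idealr_closedD.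
  by left; rewrite -[a]mul1r -c1 -mulrA mulrBl mul1r aa subrr mulr0.
have [c c1] := local_unit ml am.
by right; rewrite -[a]mul1r -{1}c1 -mulrA aa.
Qed.

End Ideals.

(** The inverse of [f x] is taken in the image of [f], so that [1 - y * x] lies in the kernel, as
    [maximal_idealP] asks. *)
Lemma maximal_ideal_ker (A B : comNzRingType) (f : {rmorphism A -> B}) :
  (forall x, f x != 0 -> exists y, f y * f x = 1) ->
  maximal_ideal [pred x | f x == 0].
Proof.
move=> finv; apply: maximal_idealP.
  split=> [||a x y]; rewrite ?inE ?rmorph0 ?rmorph1 ?oner_eq0//.
  by move=> /eqP fx /eqP fy; rewrite rmorphD rmorphM fx fy mulr0 addr0.
move=> x; rewrite inE => /finv[y fyx]; exists y.
by rewrite inE rmorphB rmorph1 rmorphM fyx subrr.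
Qed.

(** * Coordinates of the tail ring *)

Section TailRingTheory.
Variables (A : comNzRingType) (m : idealr A).
Local Notation R := (tail_ring m).
Implicit Types (a : A) (x y : R).

Lemma residue_eq0 a : (residue m a == 0) = (a \in m).
Proof. by rewrite -(rmorph0 (residue m)) -[a in RHS]subr0 -Quotient.idealrBE. Qed.

Definition tail_head x : A := (tail_val x).1.
Definition tail_coord i x : residue_ring m := (tail_val x).2 i.

Lemma tail_head_is_zmod_morphism : zmod_morphism tail_head.
Proof. by []. Qed.
Lemma tail_head_is_monoid_morphism : monoid_morphism tail_head.
Proof. by []. Qed.
HB.instance Definition _ :=
  GRing.isZmodMorphism.Build R A tail_head tail_head_is_zmod_morphism.
HB.instance Definition _ :=
  GRing.isMonoidMorphism.Build R A tail_head tail_head_is_monoid_morphism.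

Lemma tail_coord_is_zmod_morphism i : zmod_morphism (tail_coord i).
Proof. by []. Qed.
Lemma tail_coord_is_monoid_morphism i : monoid_morphism (tail_coord i).
Proof.
pose f : {rmorphism R -> (nat -> residue_ring m)} := snd \o val.
have fE x : tail_coord i x = f x i by [].
by split=> [|x y]; [rewrite fE rmorph1 | rewrite !fE rmorphM mulrfctE].
Qed.
HB.instance Definition _ i := GRing.isZmodMorphism.Build R (residue_ring m)
  (tail_coord i) (tail_coord_is_zmod_morphism i).
HB.instance Definition _ i := GRing.isMonoidMorphism.Build R (residue_ring m)
  (tail_coord i) (tail_coord_is_monoid_morphism i).

Lemma tail_ringP x y : tail_head x = tail_head y ->
  (forall i, tail_coord i x = tail_coord i y) -> x = y.
Proof.
move=> xy1 xy2; apply: val_inj; rewrite /= [tail_val x]surjective_pairing.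
rewrite [tail_val y]surjective_pairing; congr (_, _); first exact: xy1.
by apply/funext => i; exact: xy2.
Qed.

Lemma tail_diag_subproof a : (a, fun=> residue m a) \in @tail_pred A m.
Proof.
by apply/asboolP; apply: (sub_finite_set _ (finite_set0 nat)) => i /=; rewrite eqxx.
Qed.

(** The diagonal embedding of [A] provides preimages of residues under all coordinates at once. *)
Definition tail_diag a : R := TailRing (tail_diag_subproof a).

Lemma tail_zero_subproof a : a \in m -> (a, 0) \in @tail_pred A m.
Proof.
rewrite -residue_eq0 => /eqP am; apply/asboolP.
by apply: (sub_finite_set _ (finite_set0 nat)) => i /=; rewrite am eqxx.
Qed.

Lemma tail_coord_e i j : tail_coord i (tail_e m j) = (i == j)%:R.
Proof. by rewrite /tail_coord /=; case: eqP. Qed.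

Lemma tail_coord_eF i (F : {fset nat}) :
  tail_coord i (tail_eF m F) = (i \in F)%:R.
Proof.
rewrite rmorph_sum /=; under eq_bigr do rewrite tail_coord_e.
have [iF|iF] := boolP (i \in F).
  (* An [fset] has no duplicates, so exactly one term of the sum survives at position [i]. *)
  rewrite (bigD1_seq i)/= ?fset_uniq// eqxx big1 ?addr0// => j /negPf.
  by rewrite eq_sym => ->.
by rewrite big_seq big1// => j jF; case: eqP => // ij; rewrite ij jF in iF.
Qed.

Lemma tail_head_eF (F : {fset nat}) : tail_head (tail_eF m F) = 0.
Proof. by rewrite rmorph_sum big1. Qed.

(** * Radicals and idempotents over a local ring *)

Section Local.
Hypothesis hm : is_local m.

(** A representative of a nonzero class lies outside [m], so it is a unit of [A]. The inverse is
    given as a residue so that [tail_diag] can lift it. *)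
Lemma residue_inv (b : residue_ring m) : b != 0 ->
  exists a, residue m a * b = 1.
Proof.
rewrite -[b]reprK; set a := repr b => b0.
have /(local_unit hm)[c ca] : a \notin m by rewrite -residue_eq0.
by exists c; rewrite -(rmorphM (residue m)) ca rmorph1.
Qed.

Lemma residue_eq0_exp (b : residue_ring m) n : b ^+ n = 0 -> b = 0.
Proof.
move=> bn; apply: contrapT => /eqP /residue_inv[a ab].
have : (residue m a * b) ^+ n = 0 by rewrite exprMn bn mulr0.
by rewrite ab expr1n => /eqP; rewrite oner_eq0.
Qed.

(** This makes [(a, 0)] an element of the tail ring when [a] is nilpotent. *)
Lemma nil_in_max a n : a ^+ n = 0 -> a \in m.
Proof.
move=> an; rewrite -residue_eq0; apply/eqP/(@residue_eq0_exp _ n).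
by rewrite -rmorphXn an rmorph0.
Qed.

Lemma nilradical_tail_ring :
  @tail_val A m @` nilradical R =
    [set ((a, 0) : tail_ambient m) | a in nilradical A].
Proof.
apply/seteqP; split.
  move=> _ [x [n xn] <-]; exists (tail_head x).
    by exists n; rewrite -rmorphXn xn rmorph0.
  rewrite [RHS]surjective_pairing; congr (_, _); apply/funext => i.
  by apply/esym/(@residue_eq0_exp _ n); rewrite -/(tail_coord i x) -rmorphXn xn rmorph0.
(* Exponent 0 would give [1 = 0]; a positive exponent is what kills the zero sequence. *)
move=> _ [a [[|n] an] <-]; first by move/eqP: an; rewrite oner_eq0.
exists (TailRing (tail_zero_subproof (nil_in_max an))) => //.
exists n.+1; apply: tail_ringP => [|i]; rewrite rmorphXn rmorph0//.
by rewrite exprS mul0r.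
Qed.

Lemma maximal_ideal_head : maximal_ideal [pred x : R | residue m (tail_head x) == 0].
Proof.
apply: (@maximal_ideal_ker _ _ (residue m \o tail_head)) => x /residue_inv[a ax].
by exists (tail_diag a).
Qed.

Lemma maximal_ideal_coord i : maximal_ideal [pred x : R | tail_coord i x == 0].
Proof.
apply: (@maximal_ideal_ker _ _ (tail_coord i)) => x /residue_inv[a ax].
by exists (tail_diag a).
Qed.

Lemma jacobson_radical_tail_ring :
  @tail_val A m @` jacobson_radical R =
    [set ((a, 0) : tail_ambient m) | a in [set b : A | b \in m]].
Proof.
apply/seteqP; split.
  move=> _ [x xJ <-]; exists (tail_head x).
    by have := xJ _ maximal_ideal_head; rewrite inE residue_eq0.
  rewrite [RHS]surjective_pairing; congr (_, _); apply/funext => i.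
  by have := xJ _ (maximal_ideal_coord i); rewrite inE => /eqP.
move=> _ [a /= am <-]; set x := TailRing (tail_zero_subproof am).
exists x => // M Mmax; apply: contrapT => /negP /(maximal_ideal_inv Mmax)[y yM].
(* [z] is the head of [1 - y * x]; as [a] is in [m], its residue is 1, so [z] is a unit of [A]. *)
pose z := 1 - tail_head y * a.
have z1 : residue m z = 1.
  have /eqP a0 : residue m a == 0 by rewrite residue_eq0.
  by rewrite rmorphB rmorph1 rmorphM /= a0 mulr0 subr0.
have /(local_unit hm)[u uz] : z \notin m by rewrite -residue_eq0 z1 oner_eq0.
have Mid := Mmax.1; have [_ /negP M1 _] := Mid; apply: M1.
(* [1 - y (a, 0)] equals [(z, 1)], whose inverse is the image of [u]. *)
suff <- : tail_diag u * (1 - y * x) = 1 by exact: idealr_closedMl.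
apply: tail_ringP => [|i]; rewrite rmorphM rmorphB rmorph1 rmorphM //=.
have -> : tail_coord i x = 0 by [].
rewrite mulr0 subr0 mulr1.
have -> : tail_coord i (tail_diag u) = residue m u by [].
(* Since [z] has residue 1, [u] has the same residue as [u * z = 1]. *)
by rewrite -[LHS]mulr1 -z1 -rmorphM uz rmorph1.
Qed.

(** The map from [a] to [(a, 0)] matches the two nilradicals, so they vanish together. *)
Lemma reduced_tail_ring : reduced R <-> reduced A.
Proof.
have := nilradical_tail_ring => /seteqP[nilR nilA]; split=> red.
  move=> a aN; suff [x /red -> /= [<-]] : (@tail_val A m @` nilradical R) (a, 0) by [].
  by apply: nilA; exists a.
move=> x xN; have [a /red -> x0] := nilR (tail_val x) (ex_intro2 _ _ x xN erefl).
by apply: val_inj; rewrite /= -x0.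
Qed.

Lemma tail_ring_idempotent0 x : x * x = x -> tail_head x = 0 ->
  exists F : {fset nat}, x = tail_eF m F.
Proof.
move=> xx x0; have /asboolP := tail_valP x.
(* With head 0, the tail condition says that the sequence has finite support; this support is the
   required [F]. *)
rewrite [(tail_val x).1]x0 rmorph0 => xfin.
exists (fset_set [set i | tail_coord i x != 0]).
apply: tail_ringP => [|i]; first by rewrite tail_head_eF.
rewrite tail_coord_eF in_fset_set//; set b := tail_coord i x.
have bb : b * b = b by rewrite -rmorphM xx.
have [b0|b0] := eqVneq b 0; first by rewrite b0 memNset//= -/b b0 eqxx.
(* A nonzero idempotent [b] is invertible here, so cancelling it in [b * b = b] gives 1. *)
rewrite mem_set//=; have [a ab] := residue_inv b0.
by rewrite -[LHS]mul1r -{1}ab -mulrA bb.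
Qed.

Lemma tail_ring_idempotent x : x * x = x ->
  exists F : {fset nat}, x = tail_eF m F \/ x = 1 - tail_eF m F.
Proof.
move=> xx; have : tail_head x * tail_head x = tail_head x by rewrite -rmorphM xx.
case/(local_idempotent hm) => x1.
  by have [F xF] := tail_ring_idempotent0 xx x1; exists F; left.
have [||F xF] := @tail_ring_idempotent0 (1 - x).
- by rewrite mulrBl mul1r mulrBr mulr1 xx subrr subr0.
- by rewrite rmorphB rmorph1 /= x1 subrr.
- by exists F; right; rewrite -xF subKr.
Qed.

End Local.
End TailRingTheory.

Theorem proposition4p3 (A : comNzRingType) (m : idealr A) (hm : is_local m) :
  [/\ @tail_val A m @` nilradical (tail_ring m) =
        [set ((a, 0) : tail_ambient m) | a in nilradical A],
      @tail_val A m @` jacobson_radical (tail_ring m) =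
        [set ((a, 0) : tail_ambient m) | a in [set b : A | b \in m]],
      reduced (tail_ring m) <-> reduced A
    & forall x : tail_ring m, x * x = x ->
        exists F : {fset nat}, x = tail_eF m F \/ x = 1 - tail_eF m F].
Proof.
split; [exact: nilradical_tail_ring | exact: jacobson_radical_tail_ring
       | exact: reduced_tail_ring | exact: tail_ring_idempotent].
Qed.
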